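(* The Popp measure $\mathcal{P}_T$ of the trivializable subriemannian structure $\mathbb{S}^7_T=(\mathbb{S}^7,\mathcal{H}_T,\langle\cdot,\cdot\rangle)$ is given by $$\mathcal{P}_T(z)=g(z)\,d\sigma,\qquad g(z):=\left[16\left(1-2\|x\|^2\|y\|^2\right)\right]^{-3/2}\quad\text{for } z=(x,y)\in\mathbb{S}^7\subset\mathbb{R}^4\times\mathbb{R}^4=\mathbb{R}^8,$$ where $d\sigma$ is the standard volume form on $\mathbb{S}^7$.
   Context: Identify $\mathbb{R}^8=\mathbb{R}^4\times\mathbb{R}^4\cong\mathbb{H}^2$, with points $(x,y)$. Define skew-symmetric matrices $A_1,\dots,A_7\in\mathbb{R}(8)$ by their action $$A_1(x,y)=(y{\bf k},x{\bf k}),\quad A_2(x,y)=(y{\bf j},x{\bf j}),\quad A_3(x,y)=(-y{\bf i},-x{\bf i}),\quad A_4(x,y)=(y,-x),$$ $$A_5(x,y)=({\bf i}x,-{\bf i}y),\quad A_6(x,y)=({\bf j}x,-{\bf j}y),\quad A_7(x,y)=({\bf k}x,-{\bf k}y).$$ They satisfy $A_iA_j+A_jA_i=-2\delta_{ij}\,\mathrm{Id}$. Let $X_l(z)=A_lz$ be the induced (pointwise orthonormal) vector fields on $\mathbb{S}^7$. The distribution $\mathcal{H}_T=\mathrm{Span}\{X_1,X_2,X_3,X_4\}$ is bracket generating of step two, and $\langle\cdot,\cdot\rangle$ is the restriction of the standard Riemannian metric to $\mathcal{H}_T$. Popp measure: Let $(M,\mathcal{H},\langle\cdot,\cdot\rangle)$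 be a step two regular subriemannian manifold of dimension $n$ and rank $m$. For a local adapted frame $X_1,\dots,X_n$ (a frame of $TM$ with $X_1,\dots,X_m$ an orthonormal frame of $\mathcal{H}$), with dual coframe $\eta_1,\dots,\eta_n$, put $b_{ij}^k=\eta_k([X_i,X_j])$ for $1\le i,j\le m<k\le n$, $B^{kl}=\sum_{i,j=1}^m b_{ij}^kb_{ij}^l$ and $B=(B^{kl})_{k,l=m+1}^n$. The Popp measure is $\mathcal{P}=\frac{1}{\sqrt{\det B}}\,\eta_1\wedge\cdots\wedge\eta_n$ (independent of the adapted frame up to orientation). *)

(* Defs.v *)
From HB Require Import structures.
From mathcomp Require Import all_boot all_order all_algebra.
From mathcomp Require Import all_classical all_reals all_analysis.
Import Order.TTheory GRing.Theory Num.Theory.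
Import numFieldNormedType.Exports.

Set Implicit Arguments.
Unset Strict Implicit.
Unset Printing Implicit Defensive.

Local Open Scope classical_set_scope.
Local Open Scope ring_scope.

Definition dot (R : realType) (n : nat) (u v : 'rV[R]_n) : R :=
  (u *m v^T) 0 0.

Definition sphere (R : realType) (n : nat) : set 'rV[R]_n.+1 :=
  [set z | dot z z = 1].

Definition tangent (R : realType) (n : nat) (z : 'rV[R]_n.+1) :
    {vspace 'rV[R]_n.+1} :=
  lker (linfun (dot z : 'rV[R]_n.+1 -> R^o)).

(* The standard volume form of the unit sphere of R^(n+1), oriented by the
   outward normal: the contraction of dx_0 /\ ... /\ dx_n with z. *)
Definition sphere_vol (R : realType) (n : nat) (z : 'rV[R]_n.+1)
    (v : 'I_n -> 'rV[R]_n.+1) : R :=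
  \det (col_mx z (\matrix_(i < n) v i) : 'M[R]_n.+1).

(* C^k on an open set W: a differentiable map is C^(k+1) when all its
   directional derivatives are C^k. *)
Fixpoint Ck (R : realType) (n : nat) (k : nat) (W : set 'rV[R]_n.+1)
    (f : 'rV[R]_n.+1 -> 'rV[R]_n.+1) : Prop :=
  match k with
  | 0%N => forall z, W z -> {for z, continuous f}
  | k'.+1 => (forall z, W z -> differentiable f z) /\
             forall v, Ck k' W (fun z => 'D_v f z)
  end.

Definition smooth (R : realType) (n : nat) (W : set 'rV[R]_n.+1)
    (f : 'rV[R]_n.+1 -> 'rV[R]_n.+1) : Prop := forall k, Ck k W f.

(* Vector fields on an open subset of the sphere are represented by ambient
   fields on an open subset of R^(n+1) that are tangent along the sphere; at
   points of the sphere their ambient bracket is tangent, and is the bracket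
   of their restrictions (independently of the chosen extensions). *)
Definition lie_bracket (R : realType) (n : nat)
    (X Y : 'rV[R]_n.+1 -> 'rV[R]_n.+1) (z : 'rV[R]_n.+1) : 'rV[R]_n.+1 :=
  'D_(X z) Y z - 'D_(Y z) X z.

Definition frame_at (R : realType) (n : nat)
    (X : 'I_n -> 'rV[R]_n.+1 -> 'rV[R]_n.+1) (z : 'rV[R]_n.+1) :
    n.-tuple 'rV[R]_n.+1 := [tuple X i z | i < n].

(* Below, the sphere has dimension n = m + p, and carries the distribution D of
   rank m, with the metric on D being the restriction of the standard one. The
   indices 1..m are the [lshift p i], the indices m+1..n are the
   [rshift m k]. *)
Definition adapted_frame (R : realType) (m p : nat)
    (D : 'rV[R]_(m + p).+1 -> {vspace 'rV[R]_(m + p).+1})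
    (W : set 'rV[R]_(m + p).+1)
    (X : 'I_(m + p) -> 'rV[R]_(m + p).+1 -> 'rV[R]_(m + p).+1) : Prop :=
  [/\ open W,
      forall i, smooth W (X i),
      forall z, W z -> sphere z -> basis_of (tangent z) (frame_at X z),
      forall z, W z -> sphere z ->
        <<[tuple X (lshift p i) z | i < m]>>%VS = D z
    & forall z, W z -> sphere z -> forall i j : 'I_m,
        dot (X (lshift p i) z) (X (lshift p j) z) = (i == j)%:R].

(* Every point of the sphere has an adapted frame around it, whose horizontal
   brackets span the tangent space at that point modulo D. *)
Definition step_two_regular (R : realType) (m p : nat)
    (D : 'rV[R]_(m + p).+1 -> {vspace 'rV[R]_(m + p).+1}) : Prop :=
  forall z, sphere z -> exists W X,
    [/\ adapted_frame D W X, W z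
      & (D z + <<[seq lie_bracket (X (lshift p i)) (X (lshift p j)) z
                 | i <- enum 'I_m, j <- enum 'I_m]>>)%VS = tangent z].

Definition coframe (R : realType) (n : nat)
    (X : 'I_n -> 'rV[R]_n.+1 -> 'rV[R]_n.+1) (k : 'I_n)
    (z v : 'rV[R]_n.+1) : R := coord (frame_at X z) k v.

Definition struct_coef (R : realType) (m p : nat)
    (X : 'I_(m + p) -> 'rV[R]_(m + p).+1 -> 'rV[R]_(m + p).+1)
    (z : 'rV[R]_(m + p).+1) (i j : 'I_m) (k : 'I_p) : R :=
  coframe X (rshift m k) z
    (lie_bracket (X (lshift p i)) (X (lshift p j)) z).

Definition popp_mx (R : realType) (m p : nat)
    (X : 'I_(m + p) -> 'rV[R]_(m + p).+1 -> 'rV[R]_(m + p).+1)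
    (z : 'rV[R]_(m + p).+1) : 'M[R]_p :=
  \matrix_(k, l) \sum_(i < m) \sum_(j < m)
    struct_coef X z i j k * struct_coef X z i j l.

(* (eta_1 /\ ... /\ eta_n)(v_1, ..., v_n) = det (eta_k (v_l)). *)
Definition popp_form (R : realType) (m p : nat)
    (X : 'I_(m + p) -> 'rV[R]_(m + p).+1 -> 'rV[R]_(m + p).+1)
    (z : 'rV[R]_(m + p).+1) (v : 'I_(m + p) -> 'rV[R]_(m + p).+1) : R :=
  (Num.sqrt (\det (popp_mx X z)))^-1 *
  \det (\matrix_(k, l) coframe X k z (v l)).

(* [mu] is the Popp measure of the step two structure D, as a volume form on
   the oriented sphere: in every adapted frame mu is [popp_form], up to the sign
   telling whether the frame is positively oriented. By [step_two_regular] such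
   frames exist everywhere, so mu is unique on tangent vectors. *)
Definition is_popp_measure (R : realType) (m p : nat)
    (D : 'rV[R]_(m + p).+1 -> {vspace 'rV[R]_(m + p).+1})
    (mu : 'rV[R]_(m + p).+1 -> ('I_(m + p) -> 'rV[R]_(m + p).+1) -> R) :
    Prop :=
  step_two_regular D /\
  (forall W X, adapted_frame D W X -> forall z, W z -> sphere z ->
     forall v, (forall i, v i \in tangent z) ->
     mu z v = Num.sg (sphere_vol z (X^~ z)) * popp_form X z v).

(* Quaternions a + b i + c j + d k as row vectors (a, b, c, d). *)
Definition quat (R : realType) (a b c d : R) : 'rV[R]_4 :=
  \row_i [:: a; b; c; d]`_i.

Definition qmul (R : realType) (u v : 'rV[R]_4) : 'rV[R]_4 :=
  let c (w : 'rV[R]_4) (k : nat) : R := w 0 (inord k) in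
  quat
    (c u 0%N * c v 0%N - c u 1%N * c v 1%N - c u 2%N * c v 2%N - c u 3%N * c v 3%N)
    (c u 0%N * c v 1%N + c u 1%N * c v 0%N + c u 2%N * c v 3%N - c u 3%N * c v 2%N)
    (c u 0%N * c v 2%N - c u 1%N * c v 3%N + c u 2%N * c v 0%N + c u 3%N * c v 1%N)
    (c u 0%N * c v 3%N + c u 1%N * c v 2%N - c u 2%N * c v 1%N + c u 3%N * c v 0%N).

Definition qi (R : realType) : 'rV[R]_4 := quat 0 1 0 0.
Definition qj (R : realType) : 'rV[R]_4 := quat 0 0 1 0.
Definition qk (R : realType) : 'rV[R]_4 := quat 0 0 0 1.

(* X_1, ..., X_4, with z = (x, y). *)
Definition XT (R : realType) (l : 'I_4) (z : 'rV[R]_(4 + 4)) :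
    'rV[R]_(4 + 4) :=
  let x := lsubmx z in let y := rsubmx z in
  [:: row_mx (qmul y (qk R)) (qmul x (qk R));
      row_mx (qmul y (qj R)) (qmul x (qj R));
      row_mx (- qmul y (qi R)) (- qmul x (qi R));
      row_mx y (- x)]`_l.

Definition HT (R : realType) (z : 'rV[R]_(4 + 4)) :
    {vspace 'rV[R]_(4 + 4)} := <<[tuple XT l z | l < 4]>>%VS.

Definition gT (R : realType) (z : 'rV[R]_(4 + 4)) : R :=
  let x := lsubmx z in let y := rsubmx z in
  (16 * (1 - 2 * dot x x * dot y y)) `^ (- (3 / 2)).

(* Main.v *)
Require Import Defs.
From HB Require Import structures.
From mathcomp Require Import all_boot all_order all_algebra.
From mathcomp Require Import all_classical all_reals all_analysis.
From mathcomp Require Import ring lra.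
Import Order.TTheory GRing.Theory Num.Theory.
Import numFieldNormedType.Exports.

(** The vertical part of the bracket of two horizontal fields is tensorial.
    If [C] is a matrix such that [z C] is orthogonal to the horizontal space at
    every [z] of the sphere, differentiating [<z C, Y z> = 0] along [X z] gives
    [<z C, [X, Y]> = <Y C, X> - <X C, Y>], with no derivative left. Hence, with
    respect to the orthonormal frame [z C_i] given by the seven Clifford
    matrices, the structure coefficients of an arbitrary adapted frame at [z]
    are obtained from explicit antisymmetric forms on the horizontal space (one
    for each vertical index) by an orthogonal change of horizontal frame and the
    inverse of the vertical block [B] of the transition matrix. The forms are
    pairwise orthogonal with the same square norm [lam z], so that
    [B^T * popp_mx * B = lam z], and the determinant of [B] cancels against the
    change of coframe. *)

Set Implicit Arguments.
Unset Strict Implicit.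
Unset Printing Implicit Defensive.

Local Open Scope ring_scope.

(** * Bilinearity of the standard inner product *)

Section Dot.
Context {R : realType} {n : nat}.
Implicit Types (u v w : 'rV[R]_n) (c : R).

Lemma dotE u v : dot u v = \sum_i u 0 i * v 0 i.
Proof. by rewrite /dot mxE; apply: eq_bigr => i _; rewrite mxE. Qed.

Lemma dotC u v : dot u v = dot v u.
Proof. by rewrite !dotE; apply: eq_bigr => i _; rewrite mulrC. Qed.

Lemma dotDr w u v : dot w (u + v) = dot w u + dot w v.
Proof. by rewrite /dot linearD/= mulmxDr mxE. Qed.

Lemma dotZr c u v : dot u (c *: v) = c * dot u v.
Proof. by rewrite /dot linearZ/= -scalemxAr mxE. Qed.

Lemma dotNr u v : dot u (- v) = - dot u v.
Proof. by rewrite -scaleN1r dotZr mulN1r. Qed.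

Lemma dot0r u : dot u 0 = 0.
Proof. by rewrite /dot trmx0 mulmx0 mxE. Qed.

Lemma dotDl w u v : dot (u + v) w = dot u w + dot v w.
Proof. by rewrite dotC dotDr !(dotC w). Qed.

Lemma dotZl c u v : dot (c *: u) v = c * dot u v.
Proof. by rewrite dotC dotZr (dotC u). Qed.

Lemma dot_sumr (I : finType) u (F : I -> 'rV[R]_n) :
  dot u (\sum_i F i) = \sum_i dot u (F i).
Proof. by apply: (big_morph _ (dotDr u) (dot0r u)). Qed.

Lemma dot_suml (I : finType) u (F : I -> 'rV[R]_n) :
  dot (\sum_i F i) u = \sum_i dot (F i) u.
Proof. by rewrite dotC dot_sumr; apply: eq_bigr => i _; rewrite dotC. Qed.

End Dot.

(** * Differentiation along the sphere *)

(* Coordinates of the curve on the sphere through [z] with velocity [u] obtained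
   by inverse stereographic projection, when [k = |u|^2 / 4]. *)
Lemma sphere_curve_is_derive (R : realType) (k a b : R) :
  is_derive (0 : R) 1
    (fun t : R => (1 + k * t ^+ 2)^-1 * ((1 - k * t ^+ 2) * a + t * b)) b.
Proof.
have hq : is_derive (0 : R) 1 (fun t : R => 1 + k * t ^+ 2) 0.
  have -> : (fun t : R => 1 + k * t ^+ 2) = cst 1 + k *: (id ^+ 2).
    by apply/funext => t; rewrite !fctE.
  by apply: is_derive_eq; rewrite /= expr1 mulr0 scale0r scaler0 addr0.
have hp : is_derive (0 : R) 1 (fun t : R => (1 - k * t ^+ 2) * a + t * b) b.
  have -> : (fun t : R => (1 - k * t ^+ 2) * a + t * b) =
      (cst 1 - k *: (id ^+ 2)) * cst a + id * cst b.
    by apply/funext => t; rewrite !fctE.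
  apply: is_derive_eq.
  rewrite /= expr1 mulr0 scale0r !scaler0 subr0 scaler0 !add0r; exact: mulr1.
have h : 1 + k * 0 ^+ 2 != 0 :> R by rewrite expr0n/= mulr0 addr0 oner_neq0.
have hi : is_derive (0 : R) 1 (fun t : R => (1 + k * t ^+ 2)^-1) 0.
  apply: DeriveDef; first exact: derivableV.
  by rewrite deriveV// (@derive_val _ _ _ _ _ _ _ hq) scaler0.
apply: (is_derive_eq (is_deriveM hi hp)).
by rewrite scaler0 addr0 expr0n/= mulr0 addr0 invr1 scale1r.
Qed.

(** Only the restriction of [f] to the sphere is known, so the ambient derivative is read off along
    a curve that stays on the sphere and has velocity [u] at [z]. *)
Lemma derive_eq0_on_sphere (R : realType) (n : nat) (f : 'rV[R]_n.+1 -> R)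
    (W : set 'rV[R]_n.+1) (z u : 'rV[R]_n.+1) :
  open W -> W z -> sphere z -> dot z u = 0 -> differentiable f z ->
  (forall w, W w -> sphere w -> f w = 0) -> 'D_u f z = 0.
Proof.
(* This value of [k] keeps the curve [c] below on the sphere: as [u] is orthogonal to the unit
   vector [z], the squared norm of the numerator is [(1 - k t^2)^2 + 4 k t^2 = (1 + k t^2)^2]. *)
move=> oW Wz Sz zu df f0; set k := dot u u / 4.
have k0 : 0 <= k.
  by rewrite divr_ge0// dotE sumr_ge0// => i _; rewrite -expr2 sqr_ge0.
have q0 t : 1 + k * t ^+ 2 != 0.
  by rewrite gt_eqF// ltr_wpDr// mulr_ge0// sqr_ge0.
pose c (t : R) : 'rV[R]_n.+1 :=
  (1 + k * t ^+ 2)^-1 *: ((1 - k * t ^+ 2) *: z + t *: u).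
have cE i j : (fun t => c t i j) = (fun t => (1 + k * t ^+ 2)^-1 *
    ((1 - k * t ^+ 2) * z i j + t * u i j)).
  by apply/funext => t; rewrite !mxE.
have dc : derivable c (0 : R) 1.
  apply/derivable_mxP => i j; rewrite cE.
  exact: (@ex_derive _ _ _ _ _ _ _ (sphere_curve_is_derive _ _ _)).
have Dc : 'D_1 c (0 : R) = u.
  rewrite derive_mx//; apply/matrixP => i j; rewrite mxE cE.
  exact: (@derive_val _ _ _ _ _ _ _ (sphere_curve_is_derive _ _ _)).
have c0 : c 0 = z.
  by rewrite /c expr0n/= mulr0 subr0 addr0 invr1 !scale1r scale0r addr0.
have Sc t : sphere (c t).
  rewrite /sphere/= /c !(dotZl, dotZr, dotDl, dotDr) (dotC u) zu.
  have -> : dot u u = 4 * k by rewrite /k; field.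
  by have := q0 t; move: Sz; rewrite /sphere/= => -> ?; field.
have /derivable1_diffP dc1 := dc.
have dfc : differentiable f (c 0) by rewrite c0.
have <- : 'D_1 (f \o c) (0 : R) = 'D_u f z.
  rewrite deriveE; last exact: differentiable_comp.
  by rewrite diff_comp//= -(deriveE _ dc1) Dc c0 deriveE.
(* The composite is known to vanish only while the curve stays in [W], which continuity ensures near
   [0]. *)
rewrite (@near_eq_derive _ _ _ _ (cst 0)) ?derive_cst//.
have cc : {for 0, continuous c} by exact: differentiable_continuous.
have : \forall t \near (0 : R), W (c t).
  by apply: cc; rewrite c0; apply: open_nbhs_nbhs.
by apply: filterS => t Wt /=; exact: f0.
Qed.

Lemma differentiable_mulmxr (R : realType) (n p : nat) (C : 'M[R]_(n, p))
  (z : 'rV[R]_n) : differentiable (mulmxr C : 'rV[R]_n -> 'rV[R]_p) z.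
Proof.
have -> : (mulmxr C : 'rV[R]_n -> 'rV[R]_p) =
    \sum_(i < n) (fun w : 'rV[R]_n => w 0 i *: row i C).
  by apply/funext => w; rewrite fct_sumE /= mulmx_sum_row.
apply: differentiable_sum => i.
by apply: differentiableZl; exact: differentiable_coord.
Qed.

Lemma derive_mulmxr (R : realType) (n p : nat) (C : 'M[R]_(n, p))
  (u z : 'rV[R]_n) : 'D_u (mulmxr C : 'rV[R]_n -> 'rV[R]_p) z = u *m C.
Proof.
rewrite (deriveE _ (differentiable_mulmxr _ _)).
rewrite diff_lin// => w.
exact/differentiable_continuous/differentiable_mulmxr.
Qed.

Lemma is_derive_coord (R : realType) (n p : nat) (f : 'rV[R]_n -> 'rV[R]_p)
    (z u : 'rV[R]_n) (i : 'I_p) : differentiable f z ->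
  is_derive z u (fun w => f w 0 i : R) (('D_u f z) 0 i).
Proof.
move=> df; have dfu : derivable f z u by exact: diff_derivable.
apply: DeriveDef; first exact: (derivable_mxP f z u).1.
by rewrite derive_mx// mxE.
Qed.

Lemma differentiable_dot (R : realType) (n p : nat)
    (f g : 'rV[R]_n -> 'rV[R]_p) (z : 'rV[R]_n) :
  differentiable f z -> differentiable g z ->
  differentiable (fun w => dot (f w) (g w)) z.
Proof.
move=> df dg.
have -> : (fun w => dot (f w) (g w)) =
    \sum_(i < p) ((fun w => f w 0 i) * (fun w => g w 0 i)).
  by apply/funext => w; rewrite dotE fct_sumE.
apply: differentiable_sum => i; apply: differentiableM.
  exact: (@differentiable_comp _ _ _ _ f (fun w => w 0 i) z df
    (differentiable_coord _ _ _)).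
exact: (@differentiable_comp _ _ _ _ g (fun w => w 0 i) z dg
  (differentiable_coord _ _ _)).
Qed.

Lemma derive_dot (R : realType) (n p : nat)
    (f g : 'rV[R]_n -> 'rV[R]_p) (z u : 'rV[R]_n) :
  differentiable f z -> differentiable g z ->
  'D_u (fun w => dot (f w) (g w)) z =
    dot ('D_u f z) (g z) + dot (f z) ('D_u g z).
Proof.
move=> df dg.
have -> : (fun w => dot (f w) (g w)) =
    \sum_(i < p) ((fun w => f w 0 i) * (fun w => g w 0 i)).
  by apply/funext => w; rewrite dotE fct_sumE.
have h i := is_deriveM (is_derive_coord u i df)
                       (is_derive_coord u i dg).
rewrite (@derive_val _ _ _ _ _ _ _ (is_derive_sum h)).
rewrite !dotE -big_split/=; apply: eq_bigr => i _.
rewrite addrC; congr (_ + _); exact: mulrC.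
Qed.

(** Tangency of [X z] and [Y z] allows the orthogonality relations, valid only on the sphere, to be
    differentiated in these directions; each derivative of a field is thereby traded for the
    derivative of the linear map [C]. *)
Lemma dot_lie_bracket (R : realType) (n : nat)
    (X Y : 'rV[R]_n.+1 -> 'rV[R]_n.+1) (W : set 'rV[R]_n.+1)
    (C : 'M[R]_n.+1) (z : 'rV[R]_n.+1) :
  open W -> W z -> sphere z ->
  differentiable X z -> differentiable Y z ->
  dot z (X z) = 0 -> dot z (Y z) = 0 ->
  (forall w, W w -> sphere w -> dot (w *m C) (X w) = 0) ->
  (forall w, W w -> sphere w -> dot (w *m C) (Y w) = 0) ->
  dot (z *m C) (lie_bracket X Y z) =
    dot (Y z *m C) (X z) - dot (X z *m C) (Y z).
Proof.
move=> oW Wz Sz dX dY zX zY CX CY.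
suff D (Z : 'rV[R]_n.+1 -> 'rV[R]_n.+1) u : differentiable Z z ->
    dot z u = 0 -> (forall w, W w -> sphere w -> dot (w *m C) (Z w) = 0) ->
    dot (z *m C) ('D_u Z z) = - dot (u *m C) (Z z).
  by rewrite /lie_bracket dotDr dotNr !D// opprK addrC.
move=> dZ zu CZ; have dC := differentiable_mulmxr C z.
have := derive_eq0_on_sphere oW Wz Sz zu
  (differentiable_dot dC dZ) CZ.
rewrite derive_dot// derive_mulmxr/= => /eqP.
by rewrite addrC addr_eq0 => /eqP.
Qed.

(** * Smoothness of linear fields *)

Lemma Ck_cst (R : realType) (n k : nat) (W : set 'rV[R]_n.+1)
  (a : 'rV[R]_n.+1) : Ck k W (cst a).
Proof.
elim: k a => [|k IH] a /=; first by move=> z _; exact: cst_continuous.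
split=> [z _|v]; first exact: differentiable_cst.
have -> : (fun z => 'D_v (cst a) z) = cst (0 : 'rV[R]_n.+1); last exact: IH.
by apply/funext => z; exact: derive_cst.
Qed.

Lemma smooth_mulmxr (R : realType) (n : nat) (W : set 'rV[R]_n.+1)
  (C : 'M[R]_n.+1) : smooth W (mulmxr C).
Proof.
case=> [|k] /=.
  by move=> z _; exact/differentiable_continuous/differentiable_mulmxr.
split=> [z _|v]; first exact: differentiable_mulmxr.
have -> : (fun z => 'D_v (mulmxr C) z) = cst (v *m C); last exact: Ck_cst.
by apply/funext => z; exact: derive_mulmxr.
Qed.

(** * Tangent spaces, volume form and orthonormal frames *)

Lemma tangentE (R : realType) (n : nat) (z v : 'rV[R]_n.+1) :
  (v \in tangent z) = (dot z v == 0).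
Proof.
have lin : linear (dot z : 'rV[R]_n.+1 -> R^o).
  by move=> c u w; rewrite dotDr dotZr.
(* [tangent] applies [linfun] to a bare function; [lfunE] can evaluate it only once [dot z] is
   packed as a linear map. *)
pose dotL : {linear 'rV[R]_n.+1 -> R^o} :=
  HB.pack (dot z : 'rV[R]_n.+1 -> R^o) (GRing.isLinear.Build _ _ _ _ _ lin).
by rewrite memv_ker (lfunE dotL).
Qed.

Lemma mulmx_trE (R : realType) (m n p : nat) (A : 'M[R]_(m, n))
  (B : 'M[R]_(p, n)) i j : (A *m B^T) i j = dot (row i A) (row j B).
Proof. by rewrite dotE mxE; apply: eq_bigr => k _; rewrite !mxE. Qed.

Lemma mxtrace_mul_tr (R : realType) (m n : nat) (A B : 'M[R]_(m, n)) :
  \tr (A *m B^T) = \sum_i \sum_j A i j * B i j.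
Proof.
by apply: eq_bigr => i _; rewrite mxE; apply: eq_bigr => j _; rewrite mxE.
Qed.

Lemma mul_col_tr_mx (R : realType) (m1 m2 n1 n2 p : nat)
    (a : 'M[R]_(m1, p)) (b : 'M[R]_(m2, p)) (c : 'M[R]_(n1, p))
    (d : 'M[R]_(n2, p)) :
  col_mx a b *m (col_mx c d)^T =
    block_mx (a *m c^T) (a *m d^T) (b *m c^T) (b *m d^T).
Proof. by rewrite tr_col_mx mul_col_mx !mul_mx_row. Qed.

(** The product of one defining matrix with the transpose of the other is block diagonal: a corner
    [1] because [z] is a unit vector, and the Gram matrix of the two families. *)
Lemma sphere_volM (R : realType) (n : nat) (z : 'rV[R]_n.+1)
    (v w : 'I_n -> 'rV[R]_n.+1) : sphere z ->
  (forall i, dot z (v i) = 0) -> (forall i, dot z (w i) = 0) ->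
  sphere_vol z v * sphere_vol z w = \det (\matrix_(i, j) dot (v i) (w j)).
Proof.
move=> Sz zv zw; rewrite /sphere_vol -(det_tr (col_mx z (\matrix_i w i))).
rewrite -det_mulmx (@mul_col_tr_mx _ 1 n 1 n).
have -> : z *m z^T = 1.
  by apply/matrixP=> i j; rewrite !ord1 [RHS]mxE; exact: Sz.
have -> : z *m (\matrix_i w i)^T = 0.
  by apply/matrixP=> i j; rewrite mulmx_trE rowK !mxE row_id.
rewrite (@det_lblock _ 1 n) det1 mul1r.
by congr (\det _); apply/matrixP=> i j; rewrite mulmx_trE !rowK mxE.
Qed.

Lemma span_tupleP (R : realType) (m n : nat) (f : 'I_m -> 'rV[R]_n.+1)
    (V : {vspace 'rV[R]_n.+1}) :
  (<<[tuple f i | i < m]>> <= V)%VS <-> forall i, f i \in V.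
Proof.
split=> [/span_subvP fV i|fV].
  by apply: fV; apply/mapP; exists i; rewrite ?mem_enum.
by apply/span_subvP => _ /mapP[i _ ->].
Qed.

Lemma dot_span0 (R : realType) (m n : nat) (f : 'I_m -> 'rV[R]_n.+1)
    (u v : 'rV[R]_n.+1) : v \in <<[tuple f i | i < m]>>%VS ->
  (forall i, dot u (f i) = 0) -> dot u v = 0.
Proof.
move=> /coord_span -> uf; rewrite dot_sumr big1// => i _.
by rewrite dotZr nth_mktuple uf mulr0.
Qed.

Section OrthonormalFrame.
Context {R : realType} {n : nat} (z : 'rV[R]_n.+1) (e : 'I_n -> 'rV[R]_n.+1).
Hypothesis Sz : sphere z.
Hypothesis ze : forall i, dot z (e i) = 0.
Hypothesis ee : forall i j, dot (e i) (e j) = (i == j)%:R.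

(** The square matrix with rows [z] and [e i] has orthonormal rows, hence also orthonormal columns.
    This resolves the identity as [z^T z + F^T F], whose first term kills [v]. *)
Lemma orthonormal_expansion v : dot z v = 0 -> v = \sum_i dot v (e i) *: e i.
Proof.
move=> zv; pose F := \matrix_i e i.
have O1 : col_mx z F *m (col_mx z F)^T = 1%:M.
  rewrite (@mul_col_tr_mx _ 1 n 1 n).
  have -> : z *m z^T = 1.
    by apply/matrixP=> i j; rewrite !ord1 [RHS]mxE; exact: Sz.
  have zF : z *m F^T = 0.
    by apply/matrixP=> i j; rewrite mulmx_trE rowK !mxE row_id.
  rewrite zF -[F *m z^T]trmxK trmx_mul trmxK zF trmx0.
  have -> : F *m F^T = 1%:M.
    by apply/matrixP=> i j; rewrite mulmx_trE !rowK mxE.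
  by rewrite -[RHS]/(1%:M : 'M[R]_(1 + n)) scalar_mx_block.
have O2 : z^T *m z + F^T *m F = 1%:M.
  by rewrite -mul_row_col -tr_col_mx; exact: mulmx1C O1.
rewrite -[LHS]mulmx1 -O2 mulmxDr mulmxA.
have -> : v *m z^T = 0 by apply/matrixP=> i j; rewrite !ord1 [LHS]dotC mxE.
rewrite mul0mx add0r mulmxA mulmx_sum_row; apply: eq_bigr => i _.
by rewrite mulmx_trE !rowK row_id.
Qed.

Lemma sphere_vol_orthonormal : sphere_vol z e ^+ 2 = 1.
Proof.
rewrite expr2 sphere_volM//; have -> : \matrix_(i, j) dot (e i) (e j) = 1%:M.
  by apply/matrixP=> i j; rewrite !mxE.
exact: det1.
Qed.

Lemma orthonormal_basis : basis_of (tangent z) [tuple e i | i < n].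
Proof.
rewrite /basis_of eqEsubv; apply/andP; split; first (apply/andP; split).
- by apply/span_tupleP => i; rewrite tangentE ze.
- apply/subvP => v; rewrite tangentE => /eqP /orthonormal_expansion ->.
  apply: memv_suml => i _; apply/memvZ/memv_span.
  by apply/mapP; exists i; rewrite ?mem_enum.
- apply/freeP => k k0 i; have := dot0r (e i); rewrite -k0 dot_sumr (bigD1 i)//=.
  rewrite big1 => [|j ji]; last first.
    by rewrite dotZr nth_mktuple ee eq_sym (negbTE ji) mulr0.
  by rewrite addr0 dotZr nth_mktuple ee eqxx mulr1.
Qed.

End OrthonormalFrame.

(** * Distributions spanned by orthonormal linear fields *)

Section LinearFrame.
Context {R : realType} {m p : nat}.
Variables (C : 'I_(m + p) -> 'M[R]_((m + p).+1)) (lam : 'rV[R]_(m + p).+1 -> R).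

Let E i (z : 'rV[R]_(m + p).+1) := z *m C i.

Let D (z : 'rV[R]_(m + p).+1) := <<[tuple E (lshift p i) z | i < m]>>%VS.

(* The [k]-th vertical component of the brackets of the horizontal [E i]. *)
Definition linear_bracket (k : 'I_p) (z : 'rV[R]_(m + p).+1) : 'M[R]_m :=
  \matrix_(i, j) (dot (E (lshift p j) z *m C (rshift m k)) (E (lshift p i) z) -
                  dot (E (lshift p i) z *m C (rshift m k)) (E (lshift p j) z)).

Hypothesis tanE : forall z i, sphere z -> dot z (E i z) = 0.
Hypothesis orthE : forall z i j, sphere z -> dot (E i z) (E j z) = (i == j)%:R.
Hypothesis lam_gt0 : forall z, sphere z -> 0 < lam z.
Hypothesis bracketE : forall z k l, sphere z ->
  \tr (linear_bracket k z *m (linear_bracket l z)^T) = lam z *+ (k == l).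

Lemma adapted_linear_frame : adapted_frame D setT E.
Proof.
split=> //.
- exact: openT.
- by move=> i; exact: smooth_mulmxr.
- move=> z _ Sz; apply: orthonormal_basis => // *; [exact: tanE|exact: orthE].
- by move=> z _ Sz i j; rewrite orthE// (inj_eq (@lshift_inj _ _)).
Qed.

Lemma dot_horizontal z v : sphere z -> v \in D z -> dot z v = 0.
Proof. by move=> Sz /dot_span0; apply=> i; exact: tanE. Qed.

Lemma dot_vertical_horizontal z v k : sphere z -> v \in D z ->
  dot (E (rshift m k) z) v = 0.
Proof. by move=> Sz /dot_span0; apply=> i; rewrite orthE// eq_rlshift. Qed.

Lemma dot_lie_bracket_vertical X Y W z k : open W -> W z -> sphere z ->
  differentiable X z -> differentiable Y z ->
  (forall w, W w -> sphere w -> X w \in D w) ->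
  (forall w, W w -> sphere w -> Y w \in D w) ->
  dot (E (rshift m k) z) (lie_bracket X Y z) =
    dot (Y z *m C (rshift m k)) (X z) - dot (X z *m C (rshift m k)) (Y z).
Proof.
move=> oW Wz Sz dX dY XD YD.
apply: (dot_lie_bracket oW) => // [||w Ww Sw|w Ww Sw].
- exact: dot_horizontal (XD _ Wz Sz).
- exact: dot_horizontal (YD _ Wz Sz).
- exact: dot_vertical_horizontal (XD _ Ww Sw).
- exact: dot_vertical_horizontal (YD _ Ww Sw).
Qed.

(** This is the bracket formula with [C] the identity, where the right-hand side vanishes by
    symmetry of the inner product. *)
Lemma lie_bracket_tangent X Y W z : open W -> W z -> sphere z ->
  differentiable X z -> differentiable Y z ->
  (forall w, W w -> sphere w -> X w \in D w) ->
  (forall w, W w -> sphere w -> Y w \in D w) ->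
  dot z (lie_bracket X Y z) = 0.
Proof.
move=> oW Wz Sz dX dY XD YD; rewrite -[X in dot X _]mulmx1.
rewrite (dot_lie_bracket (C := 1%:M) oW) ?mulmx1// => [|||w Ww Sw|w Ww Sw].
- by rewrite dotC subrr.
- exact: dot_horizontal (XD _ Wz Sz).
- exact: dot_horizontal (YD _ Wz Sz).
- by rewrite mulmx1; exact: dot_horizontal (XD _ Ww Sw).
- by rewrite mulmx1; exact: dot_horizontal (YD _ Ww Sw).
Qed.

(** The linear frame itself serves as adapted frame everywhere. Its brackets generate the vertical
    directions because the vertical forms are orthogonal and nonzero, hence independent. *)
Lemma step_two_linear_frame : step_two_regular D.
Proof.
move=> z Sz; exists setT, E; split=> //; first exact: adapted_linear_frame.
have ED i w : sphere w -> E (lshift p i) w \in D w.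
  by move=> Sw; exact: (span_tupleP _ _).1 (subvv _) i.
set br := fun i j => lie_bracket (E (lshift p i)) (E (lshift p j)) z.
have brT i j : dot z (br i j) = 0.
  apply: (@lie_bracket_tangent _ _ setT) => // [|||w _|w _].
  - exact: openT.
  - exact: differentiable_mulmxr.
  - exact: differentiable_mulmxr.
  - exact: ED.
  - exact: ED.
have brV i j k : dot (E (rshift m k) z) (br i j) = linear_bracket k z i j.
  rewrite mxE; apply: (@dot_lie_bracket_vertical _ _ setT) => // [|||w _|w _].
  - exact: openT.
  - exact: differentiable_mulmxr.
  - exact: differentiable_mulmxr.
  - exact: ED.
  - exact: ED.
have tz i := tanE i Sz; have oz i j := orthE i j Sz.
have EDi i : E (lshift p i) z \in D z by exact: ED.
(* The horizontal part of a bracket; subtracting it leaves a combination of vertical fields with the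
   entries of [linear_bracket] as coefficients. *)
pose brD i j := \sum_h dot (br i j) (E (lshift p h) z) *: E (lshift p h) z.
set V := (_ + _)%VS.
have EV r : E r z \in V.
  case: (split_ordP r) => k ->.
    by apply: (subvP (addvSl _ _)); exact: EDi.
  (* Weighting the brackets by the [k]-th form isolates the [k]-th vertical field: by [bracketE] the
     other forms contribute zero and the [k]-th one contributes [lam z]. *)
  have -> : E (rshift m k) z = (lam z)^-1 *: \sum_i \sum_j
      linear_bracket k z i j *: (br i j - brD i j).
    have brE i j : br i j - brD i j =
        \sum_h linear_bracket h z i j *: E (rshift m h) z.
      rewrite {1}(orthonormal_expansion Sz tz oz (brT i j)).
      rewrite big_split_ord/= -/(brD i j) addrAC subrr add0r.
      by apply: eq_bigr => h _; rewrite dotC brV.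
    have -> : \sum_i \sum_j linear_bracket k z i j *:
        (br i j - brD i j) =
        \sum_h \tr (linear_bracket k z *m (linear_bracket h z)^T) *:
          E (rshift m h) z.
      transitivity (\sum_i \sum_h \sum_j
          (linear_bracket k z i j * linear_bracket h z i j) *:
            E (rshift m h) z).
        apply: eq_bigr => i _; rewrite exchange_big; apply: eq_bigr => j _.
        by rewrite brE scaler_sumr; apply: eq_bigr => h _; rewrite scalerA.
      rewrite exchange_big; apply: eq_bigr => h _.
      rewrite mxtrace_mul_tr scaler_suml; apply: eq_bigr => i _.
      by rewrite scaler_suml.
    rewrite (bigD1 k)//= big1 => [|h hk]; last first.
      by rewrite bracketE// eq_sym (negbTE hk) scale0r.
    by rewrite bracketE// eqxx addr0 scalerA mulVf ?scale1r// gt_eqF// lam_gt0.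
  apply: memvZ; apply: memv_suml => i' _; apply: memv_suml => j' _.
  apply: memvZ.
  apply: rpredB.
    apply: (subvP (addvSr _ _)); apply: memv_span; apply/allpairsP.
    by exists (i', j'); rewrite !mem_enum.
  apply: memv_suml => h _; apply: memvZ; apply: (subvP (addvSl _ _)).
  exact: EDi.
apply/eqP; rewrite eqEsubv; apply/andP; split.
  rewrite subv_add; apply/andP; split.
    by apply/span_tupleP => i; rewrite tangentE tanE.
  apply/span_subvP => _ /allpairsP[[i j] [_ _ ->]].
  by rewrite tangentE brT.
apply/subvP => v; rewrite tangentE => /eqP zv.
rewrite (orthonormal_expansion Sz tz oz zv).
by apply: memv_suml => i _; apply: memvZ; exact: EV.
Qed.

(** * Comparison of an arbitrary adapted frame with the linear one *)

Section AdaptedFrame.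
Variables (W : set 'rV[R]_(m + p).+1)
  (Y : 'I_(m + p) -> 'rV[R]_(m + p).+1 -> 'rV[R]_(m + p).+1)
  (z : 'rV[R]_(m + p).+1).
Hypotheses (frameY : adapted_frame D W Y) (Wz : W z) (Sz : sphere z).

(** Row [i] holds the coordinates of [Y i z] in the orthonormal frame [E]. The diagonal blocks [A]
    and [B] compare the horizontal frames and the vertical parts of the remaining fields. *)
Let P := \matrix_(i, j) dot (Y i z) (E j z).
Let A := ulsubmx P.
Let B := drsubmx P.

Lemma adapted_frame_tangent i : dot z (Y i z) = 0.
Proof.
have [_ _ bY _ _] := frameY; apply/eqP; rewrite -tangentE.
apply: (basis_mem (bY z Wz Sz)).
by apply/mapP; exists i; rewrite ?mem_enum.
Qed.

Lemma adapted_frame_horizontal i w : W w -> sphere w ->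
  Y (lshift p i) w \in D w.
Proof.
have [_ _ _ spanY _] := frameY; move=> Ww Sw; rewrite -spanY//.
exact: (span_tupleP (fun i => Y (lshift p i) w) _).1 (subvv _) i.
Qed.

Lemma ursubmx_frame : ursubmx P = 0.
Proof.
apply/matrixP=> i j; rewrite !mxE dotC.
by rewrite (dot_vertical_horizontal j Sz (adapted_frame_horizontal i Wz Sz)).
Qed.

Lemma frame_block : P = block_mx A 0 (dlsubmx P) B.
Proof. by rewrite -ursubmx_frame submxK. Qed.

Lemma horizontal_expansion i :
  Y (lshift p i) z = \sum_j A i j *: E (lshift p j) z.
Proof.
rewrite {1}(orthonormal_expansion Sz (fun j => tanE j Sz)
  (fun j k => orthE j k Sz) (adapted_frame_tangent _)).
rewrite big_split_ord/= [X in _ + X]big1 ?addr0 => [|j _].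
  by apply: eq_bigr => j _; rewrite !mxE.
rewrite dotC dot_vertical_horizontal ?scale0r//.
exact: adapted_frame_horizontal.
Qed.

Lemma horizontal_orthogonal : A *m A^T = 1%:M.
Proof.
have [_ _ _ _ oY] := frameY.
apply/matrixP => i j; rewrite mulmx_trE [RHS]mxE -(oY z Wz Sz).
rewrite !horizontal_expansion dot_suml dotE; apply: eq_bigr => k _.
rewrite dot_sumr (bigD1 k)//= big1 => [|l lk].
  by rewrite dotZl dotZr orthE// eqxx mulr1 addr0 !mxE.
rewrite dotZl dotZr orthE// (inj_eq (@lshift_inj _ _)) eq_sym (negbTE lk).
by rewrite !mulr0.
Qed.

Let br i j := lie_bracket (Y (lshift p i)) (Y (lshift p j)) z.

Let Yd i : differentiable (Y i) z.
Proof. by have [_ sY _ _ _] := frameY; exact: (sY i 1%N).1 z Wz. Qed.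

Let brT i j : dot z (br i j) = 0.
Proof.
have [oW _ _ _ _] := frameY.
by apply: (lie_bracket_tangent oW) => // w; exact: adapted_frame_horizontal.
Qed.

(** Being tensorial, the vertical part of the bracket transforms as a bilinear form under the
    horizontal change of frame [A]. *)
Lemma adapted_bracket_vertical i j k : dot (E (rshift m k) z) (br i j) =
  (A *m linear_bracket k z *m A^T) i j.
Proof.
have [oW _ _ _ _] := frameY.
rewrite (dot_lie_bracket_vertical k oW)//; last 2 first.
- by move=> w; exact: adapted_frame_horizontal.
- by move=> w; exact: adapted_frame_horizontal.
pose F := \matrix_i E (lshift p i) z; pose H := \matrix_i Y (lshift p i) z.
pose M := C (rshift m k).
have HF : H = A *m F.
  by apply/row_matrixP=> a; rewrite rowK horizontal_expansion row_mul
    mulmx_sum_row; apply: eq_bigr => b _; rewrite rowK; congr (_ *: _);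
    rewrite [RHS]mxE.
have YM a b : dot (Y (lshift p a) z *m M) (Y (lshift p b) z) =
    (H *m M *m H^T) a b by rewrite mulmx_trE row_mul !rowK.
(* The form is the antisymmetrization of [F M F^T], so the change of frame [H = A F] acts on each
   term by congruence. *)
have -> : linear_bracket k z = (F *m M *m F^T)^T - F *m M *m F^T.
  apply/matrixP=> a b; rewrite mxE [RHS]mxE [X in _ = X + _]mxE.
  by rewrite [X in _ = _ + X]mxE !mulmx_trE !row_mul !rowK.
rewrite !YM HF mulmxBr mulmxBl [RHS]mxE [X in _ = _ + X]mxE.
congr (_ - _); last by rewrite trmx_mul !mulmxA.
transitivity ((A *m F *m M *m (A *m F)^T)^T i j); first by rewrite [RHS]mxE.
by rewrite !trmx_mul !trmxK !mulmxA.
Qed.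

Lemma coframe_expansion v : v \in tangent z ->
  v = \sum_i coframe Y i z v *: Y i z.
Proof.
have [_ _ bY _ _] := frameY; move=> /(coord_basis (bY z Wz Sz)) {1}->.
by apply: eq_bigr => i _; rewrite nth_mktuple.
Qed.

(** The bracket is expanded in the frame [Y] and paired with a vertical [E]: the horizontal [Y] drop
    out, and the others contribute the entries of [B]. *)
Lemma struct_coef_vertical i j k :
  \sum_l struct_coef Y z i j l * B l k = (A *m linear_bracket k z *m A^T) i j.
Proof.
rewrite -adapted_bracket_vertical.
have brY : br i j \in tangent z by rewrite tangentE brT.
rewrite {1}(coframe_expansion brY) dot_sumr big_split_ord/=.
rewrite [X in _ = X + _]big1 ?add0r => [|l _]; last first.
  rewrite dotZr.
  rewrite (dot_vertical_horizontal k Sz (adapted_frame_horizontal l Wz Sz)).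
  by rewrite mulr0.
apply: eq_bigr => l _; rewrite dotZr; congr (_ * _).
by rewrite !mxE dotC.
Qed.

(** Multiplying by [B] on both sides replaces structure coefficients by the forms conjugated by [A].
    Conjugation by an orthogonal matrix preserves their trace products, which [bracketE]
    evaluates. *)
Lemma popp_mx_congr : B^T *m popp_mx Y z *m B = (lam z)%:M.
Proof.
apply/matrixP=> k l; rewrite [RHS]mxE -(bracketE k l Sz).
have AA : A^T *m A = 1%:M by exact: mulmx1C horizontal_orthogonal.
have -> : \tr (linear_bracket k z *m (linear_bracket l z)^T) =
    \tr ((A *m linear_bracket k z *m A^T) *m
         (A *m linear_bracket l z *m A^T)^T).
  rewrite !trmx_mul trmxK -!mulmxA (mulmxA A^T A) AA mul1mx [RHS]mxtrace_mulC.
  by rewrite -!mulmxA AA mulmx1.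
(* Slicing at a fixed first index [i] writes [popp_mx] as a sum of Gram matrices, to which [B] can
   be applied slice by slice. *)
pose S i := \matrix_(j, a) struct_coef Y z i j a.
have SB i j a : (S i *m B) j a = (A *m linear_bracket a z *m A^T) i j.
  by rewrite -struct_coef_vertical mxE; apply: eq_bigr => b _;
    rewrite [S _ _ _]mxE.
have -> : popp_mx Y z = \sum_i (S i)^T *m S i.
  apply/matrixP=> a b; rewrite mxE summxE; apply: eq_bigr => i _.
  by rewrite mxE; apply: eq_bigr => j _; rewrite !mxE.
rewrite mulmx_sumr mulmx_suml summxE mxtrace_mul_tr; apply: eq_bigr => i _.
rewrite mulmxA -trmx_mul -mulmxA mxE; apply: eq_bigr => j _.
by rewrite [_^T _ _]mxE !SB.
Qed.

(** The volume of [v] carries the factor [det A * det B] of the transition matrix, while the square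
    root of the Popp determinant carries [1 / |det B|]. What remains is [det A] and the sign of
    [det B], which the orientation sign of [Y] supplies. *)
Lemma popp_form_adapted v : (forall i, v i \in tangent z) ->
  Num.sg (sphere_vol z (Y^~ z)) * popp_form Y z v =
    (Num.sqrt (lam z ^+ p))^-1 * sphere_vol z v.
Proof.
move=> vT; have tz i := tanE i Sz; have oz i j := orthE i j Sz.
have zv i : dot z (v i) = 0 by apply/eqP; rewrite -tangentE.
(* The orientation of the linear frame, [1] or [-1]; its value need not be determined, since it
   enters both sides once. *)
pose eps := sphere_vol z (E^~ z).
have eps2 : eps ^+ 2 = 1 by exact: sphere_vol_orthonormal.
have volE u : (forall i, dot z (u i) = 0) -> sphere_vol z u =
    eps * \det (\matrix_(i, j) dot (u i) (E j z)).
  by move=> zu; rewrite -(sphere_volM Sz zu tz) mulrCA -expr2 eps2 mulr1.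
pose Q := \matrix_(k, l) coframe Y k z (v l).
have QP : \matrix_(i, j) dot (v i) (E j z) = Q^T *m P.
  apply/matrixP=> i j; rewrite !mxE.
  rewrite {1}(coframe_expansion (vT i)) dot_suml; apply: eq_bigr => k _.
  by rewrite dotZl !mxE.
have detP : \det P = \det A * \det B by rewrite frame_block det_lblock.
have A2 : \det A ^+ 2 = 1.
  by rewrite expr2 -{2}det_tr -det_mulmx horizontal_orthogonal det1.
have detPopp : \det B ^+ 2 * \det (popp_mx Y z) = lam z ^+ p.
  rewrite -[RHS]det_scalar -popp_mx_congr !det_mulmx det_tr; ring.
rewrite !volE//; last exact: adapted_frame_tangent.
rewrite QP det_mulmx det_tr -/P detP /popp_form -/Q -detPopp.
have lp : 0 < lam z ^+ p by rewrite exprn_gt0// lam_gt0.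
have B0 : \det B != 0.
  by apply: contraTneq lp => B0; rewrite -detPopp B0 expr0n/= mul0r ltxx.
rewrite sqrtrM ?sqr_ge0// sqrtr_sqr invfM !sgrM.
have sg1 (x : R) : x ^+ 2 = 1 -> Num.sg x = x.
  move=> /eqP; rewrite sqrf_eq1 => /orP[] /eqP ->; first exact: sgr1.
  exact: sgrN1.
have BE : \det B = Num.sg (\det B) * `|\det B| by exact: numEsg.
rewrite (sg1 _ eps2) (sg1 _ A2) [in RHS]BE normrM normr_id normr_sg B0 mul1r.
have nB0 : `|\det B| != 0 by rewrite normr_eq0.
set s := (Num.sqrt _)^-1.
by field; rewrite nB0.
Qed.
End AdaptedFrame.

Theorem popp_linear_frame mu :
  (forall z v, sphere z ->
     mu z v = (Num.sqrt (lam z ^+ p))^-1 * sphere_vol z v) ->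
  is_popp_measure D mu.
Proof.
move=> muE; split; first exact: step_two_linear_frame.
by move=> W Y frameY z Wz Sz v vT; rewrite (popp_form_adapted frameY)// muE.
Qed.

End LinearFrame.

(** * The seven Clifford fields in real coordinates *)

Section Quaternions.
Context {R : realType}.

Lemma quatP (u : 'rV[R]_4) : exists a b c d, u = quat a b c d.
Proof.
exists (u 0 (inord 0)), (u 0 (inord 1)), (u 0 (inord 2)), (u 0 (inord 3)).
apply/rowP => -[[|[|[|[|//]]]] i]; rewrite mxE /=; congr (u 0 _); apply/val_inj;
  by rewrite /= inordK.
Qed.

Lemma qmulE (a b c d a' b' c' d' : R) :
  qmul (quat a b c d) (quat a' b' c' d') =
  quat (a * a' - b * b' - c * c' - d * d') (a * b' + b * a' + c * d' - d * c')
       (a * c' - b * d' + c * a' + d * b') (a * d' + b * c' - c * b' + d * a').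
Proof. by rewrite /qmul !mxE !inordK. Qed.

Lemma quatN (a b c d : R) : - quat a b c d = quat (- a) (- b) (- c) (- d).
Proof. by apply/rowP => -[[|[|[|[|//]]]] i]; rewrite !mxE. Qed.

Lemma quat_linear (k a b c d a' b' c' d' : R) :
  k *: quat a b c d + quat a' b' c' d' =
  quat (k * a + a') (k * b + b') (k * c + c') (k * d + d').
Proof. by apply/rowP => -[[|[|[|[|//]]]] i]; rewrite !mxE. Qed.

Lemma dot_quat (a b c d a' b' c' d' : R) :
  dot (quat a b c d) (quat a' b' c' d') = a * a' + b * b' + c * c' + d * d'.
Proof. by rewrite dotE !big_ord_recl big_ord0 !mxE/= addr0 !addrA. Qed.

Lemma dot_row_mx (m n : nat) (a c : 'rV[R]_m) (b d : 'rV[R]_n) :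
  dot (row_mx a b) (row_mx c d) = dot a c + dot b d.
Proof. by rewrite /dot tr_row_mx mul_row_col mxE. Qed.

(** Writing points by eight real coordinates turns the identities between the fields into polynomial
    identities for [ring]. *)
Definition octo (a b c d e f g h : R) : 'rV[R]_(4 + 4) :=
  row_mx (quat a b c d) (quat e f g h).

Lemma octoP (z : 'rV[R]_(4 + 4)) :
  exists a b c d e f g h, z = octo a b c d e f g h.
Proof.
have [a [b [c [d xE]]]] := quatP (lsubmx z).
have [e [f [g [h yE]]]] := quatP (rsubmx z).
by exists a, b, c, d, e, f, g, h; rewrite /octo -xE -yE hsubmxK.
Qed.

Lemma dot_octo (a b c d e f g h a' b' c' d' e' f' g' h' : R) :
  dot (octo a b c d e f g h : 'rV_8) (octo a' b' c' d' e' f' g' h') =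
  a * a' + b * b' + c * c' + d * d' + (e * e' + f * f' + g * g' + h * h').
Proof. by rewrite [LHS](@dot_row_mx 4 4) !dot_quat. Qed.

Lemma octo_linear (k a b c d e f g h a' b' c' d' e' f' g' h' : R) :
  k *: octo a b c d e f g h + octo a' b' c' d' e' f' g' h' =
  octo (k * a + a') (k * b + b') (k * c + c') (k * d + d')
       (k * e + e') (k * f + f') (k * g + g') (k * h + h').
Proof. by rewrite /octo scale_row_mx add_row_mx !quat_linear. Qed.

(* [X_5], [X_6], [X_7]. *)
Definition VT (k : 'I_3) (z : 'rV[R]_(4 + 4)) : 'rV[R]_(4 + 4) :=
  let q := [:: qi R; qj R; qk R]`_k in
  row_mx (qmul q (lsubmx z)) (- qmul q (rsubmx z)).

Lemma XTE l (a b c d e f g h : R) :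
  @XT R l (octo a b c d e f g h) =
  [:: octo (- h) g (- f) e (- d) c (- b) a;
      octo (- g) (- h) e f (- c) (- d) a b;
      octo f (- e) (- h) g b (- a) (- d) c;
      octo e f g h (- a) (- b) (- c) (- d)]`_l.
Proof.
rewrite /XT /octo row_mxKl row_mxKr /qi /qj /qk !qmulE !quatN.
by case: l => [[|[|[|[|//]]]] i] /=; congr row_mx; congr quat; ring.
Qed.

Lemma VTE k (a b c d e f g h : R) :
  VT k (octo a b c d e f g h) =
  [:: octo (- b) a (- d) c f (- e) h (- g);
      octo (- c) d a (- b) g (- h) (- e) f;
      octo (- d) (- c) b a h g (- f) (- e)]`_k.
Proof.
rewrite /VT /octo row_mxKl row_mxKr /qi /qj /qk.
by case: k => [[|[|[|//]]] i] /=; rewrite !qmulE !quatN;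
  congr row_mx; congr quat; ring.
Qed.

Definition XVT (i : 'I_(4 + 3)) (z : 'rV[R]_(4 + 4)) : 'rV[R]_(4 + 4) :=
  match fintype.split i with inl l => XT l z | inr k => VT k z end.

Lemma XVT_lshift l z : XVT (lshift 3 l) z = XT l z.
Proof. by rewrite /XVT (unsplitK (inl l)). Qed.

Lemma XVT_rshift k z : XVT (rshift 4 k) z = VT k z.
Proof. by rewrite /XVT (unsplitK (inr k)). Qed.

Lemma XVT_linear i : linear (XVT i).
Proof.
move=> t z w.
have [a [b [c [d [e [f [g [h ->]]]]]]]] := octoP z.
have [a' [b' [c' [d' [e' [f' [g' [h' ->]]]]]]]] := octoP w.
rewrite octo_linear; case: (split_ordP i) => k ->.
  by rewrite !XVT_lshift !XTE; case: k => [[|[|[|[|//]]]] ?] /=;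
    rewrite octo_linear; congr octo; ring.
by rewrite !XVT_rshift !VTE; case: k => [[|[|[|//]]] ?] /=;
  rewrite octo_linear; congr octo; ring.
Qed.

Definition XVT_mx (i : 'I_(4 + 3)) : 'M[R]_(4 + 4) := lin1_mx (XVT i).

Lemma mul_XVT_mx z i : z *m XVT_mx i = XVT i z.
Proof.
pose f : {linear 'rV[R]_(4 + 4) -> 'rV[R]_(4 + 4)} :=
  HB.pack (XVT i) (GRing.isLinear.Build _ _ _ _ _ (XVT_linear i)).
exact: (mul_rV_lin1 f).
Qed.

Lemma dot_XVT (z : 'rV[R]_8) i : dot z (XVT i z : 'rV_8) = 0.
Proof.
have [a [b [c [d [e [f [g [h ->]]]]]]]] := octoP z.
case: (split_ordP i) => k ->.
  by rewrite XVT_lshift XTE; case: k => [[|[|[|[|//]]]] ?] /=;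
    rewrite dot_octo; ring.
by rewrite XVT_rshift VTE; case: k => [[|[|[|//]]] ?] /=;
  rewrite dot_octo; ring.
Qed.

(** The factor [dot z z] makes both sides homogeneous of degree two, so that the identity holds off
    the sphere as well. *)
Lemma dot_XVT2 (z : 'rV[R]_8) i j :
  dot (XVT i z : 'rV_8) (XVT j z) = (i == j)%:R * dot z z.
Proof.
have [a [b [c [d [e [f [g [h ->]]]]]]]] := octoP z.
case: (split_ordP i) => k ->; case: (split_ordP j) => l ->;
  rewrite ?XVT_lshift ?XVT_rshift ?XTE ?VTE;
  rewrite ?eq_lshift ?eq_rshift ?eq_lrshift ?eq_rlshift.
- by case: k => [[|[|[|[|//]]]] ?]; case: l => [[|[|[|[|//]]]] ?] /=;
    rewrite !dot_octo; ring.
- by case: k => [[|[|[|[|//]]]] ?]; case: l => [[|[|[|//]]] ?] /=;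
    rewrite !dot_octo; ring.
- by case: k => [[|[|[|//]]] ?]; case: l => [[|[|[|[|//]]]] ?] /=;
    rewrite !dot_octo; ring.
- by case: k => [[|[|[|//]]] ?]; case: l => [[|[|[|//]]] ?] /=;
    rewrite !dot_octo; ring.
Qed.

End Quaternions.

(** * The trace products of the brackets, and the density on the seven-sphere *)

Lemma linear_bracketE (R : realType) (z : 'rV[R]_8) k i j :
  @linear_bracket R 4 3 XVT_mx k z i j =
  dot (VT k (XT j z) : 'rV_8) (XT i z) - dot (VT k (XT i z) : 'rV_8) (XT j z).
Proof.
by rewrite mxE !mul_XVT_mx !XVT_lshift !XVT_rshift.
Qed.

(** On the sphere the squared sum equals [1]; keeping it makes the formula a homogeneous quartic
    identity, checked for each pair of vertical indices. *)
Lemma linear_bracket_trace (R : realType) (z : 'rV[R]_(4 + 4)) k l :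
  let x := lsubmx z in let y := rsubmx z in
  \tr (@linear_bracket R 4 3 XVT_mx k z *m (linear_bracket XVT_mx l z)^T) =
  16 * ((dot x x + dot y y) ^+ 2 - 2 * dot x x * dot y y) *+ (k == l).
Proof.
rewrite mxtrace_mul_tr.
have [a [b [c [d [e [f [g [h ->]]]]]]]] := octoP z.
rewrite /octo row_mxKl row_mxKr !dot_quat -/(octo _ _ _ _ _ _ _ _).
under eq_bigr do under eq_bigr do rewrite !linear_bracketE !XTE.
rewrite !big_ord_recl !big_ord0 /= !VTE.
case: k => [[|[|[|//]]] ?]; case: l => [[|[|[|//]]] ?] /=;
  by rewrite !dot_octo; ring.
Qed.

Theorem lemma5p2 (R : realType) :
  @is_popp_measure R 4 3 (@HT R) (fun z v => @gT R z * sphere_vol z v).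
Proof.
have -> : @HT R = fun z : 'rV[R]_8 =>
    <<[tuple z *m XVT_mx (lshift 3 i) | i < 4]>>%VS.
  apply/funext => z; congr (<<tval _>>%VS); apply: eq_mktuple => i.
  by rewrite mul_XVT_mx XVT_lshift.
pose lam (z : 'rV[R]_(4 + 4)) :=
  16 * (1 - 2 * dot (lsubmx z) (lsubmx z) * dot (rsubmx z) (rsubmx z)).
have normz (z : 'rV[R]_8) : @sphere R 7 z ->
    dot (lsubmx (z : 'rV_(4 + 4))) (lsubmx (z : 'rV_(4 + 4))) +
    dot (rsubmx (z : 'rV_(4 + 4))) (rsubmx (z : 'rV_(4 + 4))) = 1.
  by move=> <-; rewrite -dot_row_mx hsubmxK.
have lam_gt0 (z : 'rV[R]_8) : @sphere R 7 z -> 0 < lam z.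
  rewrite /lam => /normz; set X := dot _ _; set Y := dot _ _ => XY.
  have -> : X = 1 - Y by rewrite -XY addrK.
  (* Positivity comes from [1 - 2 (1 - Y) Y = (1 + (2 Y - 1)^2) / 2]. *)
  by have := sqr_ge0 (2 * Y - 1); nra.
apply: (@popp_linear_frame R 4 3 XVT_mx lam) => //
  [z i Sz|z i j Sz|z k l Sz|z v Sz].
- by rewrite mul_XVT_mx dot_XVT.
- by rewrite !mul_XVT_mx dot_XVT2 Sz mulr1.
- by rewrite linear_bracket_trace normz// expr1n.
(* With three vertical directions the factor is [1 / sqrt (lam^3)], which is [lam] to the power
   [-3/2]; splitting the exponent requires [lam] to be nonnegative. *)
- congr (_ * _); rewrite /gT -/(lam z) powRN; congr _^-1.
  rewrite powRrM powR_mulrn ?powR12_sqrt ?exprn_ge0//; exact/ltW/lam_gt0.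
Qed.
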